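(* Let $R$ be a ring and let $S$ be a multiplicatively closed subset of $R$ such that $S \cap Z(R) = \emptyset$. If $I$ is a weakly semiprimary ideal of $R$ and $S \cap \sqrt{I} = \emptyset$, then $I_S$ is a weakly semiprimary ideal of $R_S$.
   Context: All rings are commutative with $1 \neq 0$. $Z(R)$ is the set of all zerodivisors of $R$. $R_S = S^{-1}R$ is the localization of $R$ at the multiplicatively closed set $S$, and $I_S = S^{-1}I$ is the extension of $I$ to $R_S$. An ideal $I$ is proper if it is not the whole ring; $\sqrt{I}$ denotes the radical of $I$. A proper ideal $I$ of a ring $R$ is weakly semiprimary if whenever $a,b\in R$ and $0 \neq ab \in I$, then $a \in \sqrt{I}$ or $b \in \sqrt{I}$. *)

(* Defs.v *)
From HB Require Import structures.
From mathcomp Require Import all_boot all_algebra.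
From mathcomp Require Import ring.
From mathcomp Require Import boolp.

Set Implicit Arguments.
Unset Strict Implicit.
Unset Printing Implicit Defensive.

Import GRing.Theory.

Local Open Scope ring_scope.
Local Open Scope quotient_scope.

(* Subsets of a ring are boolean predicates {pred R}, as in the algebraic     *)
(* closure predicates of ssralg; `[< P >] reflects an arbitrary proposition,  *)
(* so this is no restriction on the subsets considered.                       *)

Section Ideals.
(* The zero ring is allowed here because a localization may be trivial a      *)
(* priori; a ring with a proper ideal is automatically nontrivial.            *)
Variable R : comPzRingType.
Implicit Types I : {pred R}.

Definition zerodivisors : {pred R} :=
  [pred x | `[< exists2 y : R, y != 0 & x * y = 0 >] ].

(* idealr_closed of ring_quotient, which requires 1 != 0 in its base ring. *)
Definition proper_ideal_closed I : Prop :=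
  [/\ 0 \in I, 1 \notin I & forall a, {in I &, forall u v, a * u + v \in I}].

Definition radical I : {pred R} :=
  [pred x | `[< exists2 n, (0 < n)%N & x ^+ n \in I >] ].

Definition weakly_semiprimary I : Prop :=
  proper_ideal_closed I /\
  forall a b : R, 0 != a * b -> a * b \in I -> a \in radical I \/ b \in radical I.

End Ideals.

Arguments zerodivisors R : clear implicits.

Lemma proper_ideal_closedE (R : comNzRingType) (I : {pred R}) :
  proper_ideal_closed I = idealr_closed I.
Proof. by []. Qed.

(* The localization of R at S: pairs (a, s) with s in S, read as a / s, modulo *)
(* (a, s) ~ (b, t) iff u * (a * t - b * s) = 0 for some u in S. The structure  *)
(* mulrClosed R requires 1 to be in S.                                         *)
Module Localization.
Section Localization.

Variables (R : comPzRingType) (S : mulrClosed R).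

Definition denom : Type := {s : R | s \in S}.
HB.instance Definition _ := Choice.on denom.

Lemma denomP (s : denom) : sval s \in S. Proof. exact: valP. Qed.

Definition pair : Type := (R * denom)%type.
HB.instance Definition _ := Choice.on pair.

Implicit Types (x y z : pair) (s t : denom).

Local Notation num x := (x.1).
Local Notation den x := (sval x.2).

Definition equivl x y : bool :=
  `[< exists2 u : R, u \in S & u * (num x * den y - num y * den x) = 0 >].

Lemma equivl_refl : reflexive equivl.
Proof.
by move=> x; apply/asboolP; exists 1; rewrite ?rpred1 // subrr mulr0.
Qed.

Lemma equivl_sym : symmetric equivl.
Proof.
by move=> x y; apply/asboolP/asboolP => -[u uS e]; exists u => //;
  rewrite -opprB mulrN e oppr0.
Qed.

Lemma equivl_trans : transitive equivl.
Proof.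
move=> y x z /asboolP[u uS exy] /asboolP[v vS eyz].
apply/asboolP; exists (u * v * den y); first by rewrite !rpredM ?denomP.
rewrite (_ : _ * _ =
    v * den z * (u * (num x * den y - num y * den x)) +
    u * den x * (v * (num y * den z - num z * den y))); last by ring.
by rewrite exy eyz !mulr0 addr0.
Qed.

Canonical equivl_equiv := EquivRel equivl equivl_refl equivl_sym equivl_trans.

Definition type : Type := {eq_quot equivl}.
HB.instance Definition _ : EqQuotient _ equivl type := EqQuotient.on type.
HB.instance Definition _ := Choice.on type.

Lemma eq_pi x y : reflect
  (exists2 u : R, u \in S & u * (num x * den y - num y * den x) = 0)
  (\pi_type x == \pi_type y).
Proof. by rewrite piE; apply: asboolP. Qed.

Definition denom1 : denom := exist _ 1 (rpred1 S).
Lemma denomM_subproof s t : sval s * sval t \in S.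
Proof. exact: rpredM (denomP s) (denomP t). Qed.
Definition denomM s t : denom := exist _ (sval s * sval t) (denomM_subproof s t).

Definition zerol : pair := (0, denom1).
Definition onel : pair := (1, denom1).
Definition oppl x : pair := (- num x, x.2).
Definition addl x y : pair :=
  (num x * den y + num y * den x, denomM x.2 y.2).
Definition mull x y : pair := (num x * num y, denomM x.2 y.2).

Definition zero : type := lift_cst type zerol.
Definition one : type := lift_cst type onel.
Definition opp := lift_op1 type oppl.
Definition add := lift_op2 type addl.
Definition mul := lift_op2 type mull.

Canonical pi_zero_morph := PiConst zero.
Canonical pi_one_morph := PiConst one.

Lemma pi_opp : {morph \pi_type : x / oppl x >-> opp x}.
Proof.
move=> x; unlock opp; apply/eqP/eq_pi.
have /eqP/eq_pi[u uS e] := esym (reprK (\pi_type x)).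
set x' := repr (\pi_type x) in e *.
exists u; rewrite //= (_ : _ * _ =
  - (u * (num x * den x' - num x' * den x))); last by ring.
by rewrite e oppr0.
Qed.
Canonical pi_opp_morph := PiMorph1 pi_opp.

Lemma pi_add : {morph \pi_type : x y / addl x y >-> add x y}.
Proof.
move=> x y; unlock add; apply/eqP/eq_pi.
have /eqP/eq_pi[u uS e] := esym (reprK (\pi_type x)).
have /eqP/eq_pi[v vS f] := esym (reprK (\pi_type y)).
set x' := repr (\pi_type x) in e *; set y' := repr (\pi_type y) in f *.
exists (u * v); first exact: rpredM.
rewrite /= (_ : _ * _ =
  v * den y * den y' * (u * (num x * den x' - num x' * den x)) +
  u * den x * den x' * (v * (num y * den y' - num y' * den y))); last by ring.
by rewrite e f !mulr0 addr0.
Qed.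
Canonical pi_add_morph := PiMorph2 pi_add.

Lemma pi_mul : {morph \pi_type : x y / mull x y >-> mul x y}.
Proof.
move=> x y; unlock mul; apply/eqP/eq_pi.
have /eqP/eq_pi[u uS e] := esym (reprK (\pi_type x)).
have /eqP/eq_pi[v vS f] := esym (reprK (\pi_type y)).
set x' := repr (\pi_type x) in e *; set y' := repr (\pi_type y) in f *.
exists (u * v); first exact: rpredM.
rewrite /= (_ : _ * _ =
  v * num y * den y' * (u * (num x * den x' - num x' * den x)) +
  u * num x' * den x * (v * (num y * den y' - num y' * den y))); last by ring.
by rewrite e f !mulr0 addr0.
Qed.
Canonical pi_mul_morph := PiMorph2 pi_mul.

Lemma addA : associative add.
Proof.
elim/quotW=> x; elim/quotW=> y; elim/quotW=> z; rewrite !piE.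
by apply/eqP/eq_pi; exists 1; rewrite ?rpred1 //=; ring.
Qed.

Lemma addC : commutative add.
Proof.
elim/quotW=> x; elim/quotW=> y; rewrite !piE.
by apply/eqP/eq_pi; exists 1; rewrite ?rpred1 //=; ring.
Qed.

Lemma add0l : left_id zero add.
Proof.
elim/quotW=> x; rewrite !piE.
by apply/eqP/eq_pi; exists 1; rewrite ?rpred1 //=; ring.
Qed.

Lemma addNl : left_inverse zero opp add.
Proof.
elim/quotW=> x; rewrite !piE.
by apply/eqP/eq_pi; exists 1; rewrite ?rpred1 //=; ring.
Qed.

HB.instance Definition _ := GRing.isZmodule.Build type addA addC add0l addNl.

Lemma mulA : associative mul.
Proof.
elim/quotW=> x; elim/quotW=> y; elim/quotW=> z; rewrite !piE.
by apply/eqP/eq_pi; exists 1; rewrite ?rpred1 //=; ring.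
Qed.

Lemma mulC : commutative mul.
Proof.
elim/quotW=> x; elim/quotW=> y; rewrite !piE.
by apply/eqP/eq_pi; exists 1; rewrite ?rpred1 //=; ring.
Qed.

Lemma mul1l : left_id one mul.
Proof.
elim/quotW=> x; rewrite !piE.
by apply/eqP/eq_pi; exists 1; rewrite ?rpred1 //=; ring.
Qed.

Lemma mul_addl : left_distributive mul add.
Proof.
elim/quotW=> x; elim/quotW=> y; elim/quotW=> z; rewrite !piE.
by apply/eqP/eq_pi; exists 1; rewrite ?rpred1 //=; ring.
Qed.

HB.instance Definition _ :=
  GRing.Zmodule_isComPzRing.Build type mulA mulC mul1l mul_addl.

End Localization.
End Localization.
HB.export Localization.

Notation localization := Localization.type.
Notation denom := Localization.denom.

Section LocalizationTheory.

Variables (R : comPzRingType) (S : mulrClosed R).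
Implicit Types (a b : R) (s t : denom S) (I : {pred R}).

Definition locfrac a s : localization S := \pi_(localization S) (a, s).

Definition tolocal a : localization S := locfrac a (Localization.denom1 S).

Definition localized_ideal I : {pred localization S} :=
  [pred x | `[< exists2 a, a \in I & exists s, x = locfrac a s >] ].

Lemma locfracW x : exists a s, x = locfrac a s.
Proof. by elim/quotW: x => -[a s]; exists a, s. Qed.

Lemma locfrac_eqP a b s t : reflect
  (exists2 u, u \in S & u * (a * sval t - b * sval s) = 0)
  (locfrac a s == locfrac b t).
Proof. exact: (Localization.eq_pi (a, s) (b, t)). Qed.

Lemma locfracD a b s t : locfrac a s + locfrac b t =
  locfrac (a * sval t + b * sval s) (Localization.denomM s t).
Proof. by rewrite /locfrac [RHS](Localization.pi_add (a, s) (b, t)). Qed.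

Lemma locfracM a b s t : locfrac a s * locfrac b t =
  locfrac (a * b) (Localization.denomM s t).
Proof. by rewrite /locfrac [RHS](Localization.pi_mul (a, s) (b, t)). Qed.

Lemma locfrac0 : 0 = locfrac 0 (Localization.denom1 S).
Proof. by rewrite /locfrac -[LHS]/(Localization.zero S) piE. Qed.

Lemma locfrac1 : 1 = locfrac 1 (Localization.denom1 S).
Proof. by rewrite /locfrac -[LHS]/(Localization.one S) piE. Qed.

Lemma tolocal_is_zmod_morphism : zmod_morphism tolocal.
Proof.
move=> a b; apply/esym/(canLR (addrK _)).
rewrite /tolocal locfracD; apply/eqP/locfrac_eqP.
by exists 1; rewrite ?rpred1 //=; ring.
Qed.

Lemma tolocal_is_monoid_morphism : monoid_morphism tolocal.
Proof.
split=> [|a b]; first by rewrite /tolocal -locfrac1.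
rewrite /tolocal locfracM; apply/eqP/locfrac_eqP.
by exists 1; rewrite ?rpred1 //=; ring.
Qed.

HB.instance Definition _ := GRing.isZmodMorphism.Build R (localization S)
  tolocal tolocal_is_zmod_morphism.
HB.instance Definition _ := GRing.isMonoidMorphism.Build R (localization S)
  tolocal tolocal_is_monoid_morphism.

Lemma locfracK a s : tolocal (sval s) * locfrac a s = tolocal a.
Proof.
rewrite /tolocal locfracM; apply/eqP/locfrac_eqP.
by exists 1; rewrite ?rpred1 //=; ring.
Qed.

End LocalizationTheory.

Arguments tolocal {R} S a.
Arguments localized_ideal {R} S I.

(* S^-1 I is the extension of I along R -> S^-1 R: the least additive subset   *)
(* stable under multiplication by S^-1 R that contains the image of I.         *)
Section LocalizedIdeal.

Variables (R : comPzRingType) (S : mulrClosed R) (I : {pred R}).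
Hypothesis I0 : 0 \in I.
Hypothesis IL : forall a, {in I &, forall u v, a * u + v \in I}.

Lemma localized_ideal0 : 0 \in localized_ideal S I.
Proof. by apply/asboolP; exists 0 => //; eexists; apply: locfrac0. Qed.

Lemma localized_idealL c :
  {in localized_ideal S I &, forall x y, c * x + y \in localized_ideal S I}.
Proof.
move=> _ _ /asboolP[a aI [s ->]] /asboolP[b bI [t ->]].
have [d [u ->]] := locfracW c.
apply/asboolP; rewrite locfracM locfracD /=; eexists; last by eexists.
have IM e f : f \in I -> e * f \in I by move=> fI; rewrite -[_ * _]addr0 IL.
by rewrite mulrAC IL // mulrC IM.
Qed.

Lemma tolocal_localized_ideal a : a \in I -> tolocal S a \in localized_ideal S I.
Proof. by move=> aI; apply/asboolP; exists a => //; eexists. Qed.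

Lemma localized_ideal_min (J : {pred localization S}) :
  0 \in J -> (forall c, {in J &, forall x y, c * x + y \in J}) ->
  {in I, forall a, tolocal S a \in J} -> {subset localized_ideal S I <= J}.
Proof.
move=> J0 JL IJ _ /asboolP[a aI [s ->]].
rewrite (_ : locfrac a s = locfrac 1 s * tolocal S a + 0) ?JL ?IJ //.
rewrite addr0 locfracM; apply/eqP/locfrac_eqP.
by exists 1; rewrite ?rpred1 //=; ring.
Qed.

End LocalizedIdeal.

(* Main.v *)
Require Import Defs.
From HB Require Import structures.
From mathcomp Require Import all_boot all_algebra.
From mathcomp Require Import boolp.

(** A fraction [a / s] lies in [I_S] exactly when some [c] in [S] satisfies
    [c a \in I] ([locfrac_mem_localizedP]); this turns every question about
    [I_S] into one about [I], and the denominators disappear.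

    If [1] were in [I_S], some [c] in [S] would be in [I], hence in its radical.
    Suppose now that [0 <> (a / s) (b / t)] is in [I_S]. Then [c a b \in I] for
    some [c] in [S], and [c a b <> 0] because [c a b = 0] would make the fraction
    zero. So [I] being weakly semiprimary applies to the product [(c a) b]: either
    [c a] or [b] is in the radical of [I]. The factor [c] is harmless, since it
    becomes a unit in [R_S] ([locfrac_mem_radical]), and so [a / s] or [b / t] is
    in the radical of [I_S]. *)

Import GRing.Theory.

Local Open Scope ring_scope.

Section LocalizedIdealMembership.

Variables (R : comPzRingType) (S : mulrClosed R) (I : {pred R}).
Hypothesis I0 : 0 \in I.
Hypothesis IL : forall a, {in I &, forall u v, a * u + v \in I}.

Lemma ideal_mull (c a : R) : a \in I -> c * a \in I.
Proof. by move=> aI; rewrite -[c * a]addr0 IL. Qed.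

(** The equality [a / s = b / t] with [b \in I] gives [u t a = u s b \in I], so
    [c := u t] clears the denominators; conversely [a / s = (c a) / (c s)]. *)
Lemma locfrac_mem_localizedP (a : R) (s : denom S) :
  reflect (exists2 c, c \in S & c * a \in I)
          (locfrac a s \in localized_ideal S I).
Proof.
apply: (iffP (asboolP _)) => [[b bI [t /eqP/locfrac_eqP[u uS]]]|[c cS caI]].
  rewrite mulrBr => /eqP; rewrite subr_eq0 => /eqP e.
  exists (u * sval t); first by rewrite rpredM ?Localization.denomP.
  by rewrite mulrAC -mulrA e [b * _]mulrC mulrA ideal_mull.
exists (c * a) => //; exists (Localization.denomM (exist _ c cS) s).
apply/eqP/locfrac_eqP; exists 1; rewrite ?rpred1 //= mul1r.
by rewrite mulrA [a * c]mulrC subrr.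
Qed.

End LocalizedIdealMembership.

Lemma locfrac_eq0 (R : comPzRingType) (S : mulrClosed R) (a c : R)
    (s : denom S) :
  c \in S -> c * a = 0 -> locfrac a s = 0.
Proof.
move=> cS ca0; rewrite [RHS]locfrac0; apply/eqP/locfrac_eqP.
by exists c; rewrite //= mulr1 mul0r subr0.
Qed.

(** Only the numerator of a power matters for membership in [I_S], hence the
    unspecified denominator. *)
Lemma locfracX (R : comPzRingType) (S : mulrClosed R) (a : R) (s : denom S) n :
  exists t : denom S, locfrac a s ^+ n = locfrac (a ^+ n) t.
Proof.
elim: n => [|n [t IHn]].
  by exists (Localization.denom1 S); rewrite !expr0 [LHS]locfrac1.
by exists (Localization.denomM s t); rewrite !exprS IHn locfracM.
Qed.

(** If [(c a)^n = c^n a^n] is in [I], then [c^n], which is in [S], witnesses that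
    [(a / s)^n] is in [I_S]. *)
Lemma locfrac_mem_radical (R : comPzRingType) (S : mulrClosed R) (I : {pred R})
    (a c : R) (s : denom S) :
  proper_ideal_closed I -> c \in S -> c * a \in radical I ->
  locfrac a s \in radical (localized_ideal S I).
Proof.
move=> [I0 _ IL] cS /asboolP[n n_gt0 canI].
apply/asboolP; exists n => //; have [t ->] := locfracX _ S a s n.
apply/(locfrac_mem_localizedP _ _ _ I0 IL).
by exists (c ^+ n); rewrite ?rpredX // -exprMn.
Qed.

Lemma localized_ideal_proper (R : comPzRingType) (S : mulrClosed R)
    (I : {pred R}) :
  proper_ideal_closed I -> [predI S & radical I] =i pred0 ->
  proper_ideal_closed (localized_ideal S I).
Proof.
move=> [I0 _ IL] SI0; split; first exact: localized_ideal0.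
  rewrite locfrac1; apply/negP => /(locfrac_mem_localizedP _ _ _ I0 IL)[c cS].
  rewrite mulr1 => cI; have := SI0 c; rewrite !inE cS /= => /asboolP[].
  by exists 1%N.
by move=> c; apply: localized_idealL.
Qed.

Theorem theorem3p1 (R : comNzRingType) (S : mulrClosed R) (I : {pred R}) :
  [predI S & zerodivisors R] =i pred0 ->
  weakly_semiprimary I ->
  [predI S & radical I] =i pred0 ->
  weakly_semiprimary (localized_ideal S I).
Proof.
move=> _ [Iid Isemi] SI0; split; first exact: localized_ideal_proper.
have [I0 _ IL] := Iid.
move=> x y; have [a [s ->]] := locfracW x; have [b [t ->]] := locfracW y.
rewrite locfracM => ab_neq0 /(locfrac_mem_localizedP _ _ _ I0 IL)[c cS].
rewrite mulrA => cabI.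
have cab_neq0 : 0 != c * a * b.
  apply: contraNneq ab_neq0 => /esym; rewrite -mulrA => cab0.
  by rewrite (locfrac_eq0 _ _ _ _ _ cS cab0).
have [caI | bI] := Isemi _ _ cab_neq0 cabI.
  by left; apply: locfrac_mem_radical caI.
by right; apply: (@locfrac_mem_radical _ _ _ _ 1); rewrite ?rpred1 ?mul1r.
Qed.
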